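(* Let $n\ge 1$ and let $\Delta$ be an upward equilateral triangle of side length $n$ divided into $n^2$ unit triangles. Let $S$ be a spread-out set of $n$ upward unit triangles in $\Delta$. Then $S$ induces a unique tiling, i.e. $\Delta\setminus\bigcup_{s\in S}s$ has exactly one rhombus tiling, if and only if, starting from $S$, one can repeatedly replace two elements $s_1,s_2$ of the current set such that $s_1\cap s_2$ is a single point with the single triangle $s_1\vee s_2$, until there is only one element, which is the entire triangle $\Delta$.
   Context: All triangles are equilateral and grid-aligned, i.e. their vertices are vertices of the unit triangular grid on $\Delta$; ''upward'' means having the same orientation as $\Delta$. A rhombus is the union of two unit grid triangles sharing an edge, and a rhombus tiling of a region is a partition (up to boundaries) of its unit triangles into rhombi. A set of $n$ distinct upward unit grid triangles in $\Delta$ is spread-out if every upward grid-aligned triangle of side length $k$ in $\Delta$ contains at most $k$ of them. For upward triangles $s_1,s_2$, $s_1\vee s_2$ denotes the smallest upward triangle containing both $s_1$ and $s_2$. For $n=1$ no replacement is needed. *)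

(* Defs.v *)
From HB Require Import structures.
From mathcomp Require Import all_boot all_order all_algebra.
From mathcomp Require Import boolp classical_sets reals.
From Stdlib Require Import Relation_Operators.

Set Implicit Arguments.
Unset Strict Implicit.
Unset Printing Implicit Defensive.

Import GRing.Theory Num.Theory.
Local Open Scope nat_scope.

(* The plane carries the affine coordinates in which Delta has vertices
   (0,0), (n,0), (0,n) and the vertices of the unit triangular grid on Delta are
   the pairs of naturals (x, y) with x + y <= n.
   The tuple (b, x, y, k) encodes the grid-aligned triangle of side length k with
   vertices (x, y), (x + k, y), (x, y + k) if b = true (upward), and
   (x, y), (x - k, y), (x, y - k) if b = false (downward). [wf_tri] says that
   the triangle is nondegenerate and lies in Delta. *)
Definition wf_tri n (t : bool * 'I_n.+1 * 'I_n.+1 * 'I_n.+1) : bool :=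
  let: (b, x, y, k) := t in
  (0 < k) &&
  (if b then x + y + k <= n else [&& k <= x, k <= y & x + y <= n]).

Record tri n := Tri {
  tri_data :> bool * 'I_n.+1 * 'I_n.+1 * 'I_n.+1;
  tri_wf : wf_tri tri_data }.

HB.instance Definition _ n := [isSub for @tri_data n].
HB.instance Definition _ n := [Countable of tri n by <:].
HB.instance Definition _ n := [Finite of tri n by <:].

Section Triangles.
Variable n : nat.
Implicit Types (s t : tri n) (A B : {set tri n}).

Definition upward t : bool := (tri_data t).1.1.1.
Definition xcoord t : nat := (tri_data t).1.1.2.
Definition ycoord t : nat := (tri_data t).1.2.
Definition side t : nat := (tri_data t).2.

Definition vertices t : seq (nat * nat) :=
  let: (x, y, k) := (xcoord t, ycoord t, side t) in
  if upward t then [:: (x, y); (x + k, y); (x, y + k)]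
  else [:: (x, y); (x - k, y); (x, y - k)].

Lemma whole_wf (hn : 0 < n) : wf_tri (true, ord0, ord0, @ord_max n).
Proof. by rewrite /wf_tri /= hn /= add0n leqnn. Qed.

(* The triangle Delta itself. *)
Definition whole (hn : 0 < n) : tri n := Tri (whole_wf hn).

(* Used for unit triangles: an edge is a pair of vertices. *)
Definition share_edge s t : bool :=
  size [seq v <- vertices s | v \in vertices t] == 2.

Definition rhombus (P : {set tri n}) : Prop :=
  exists s t, [/\ side s = 1, side t = 1, s != t, share_edge s t
                & P = [set s; t]%SET].

(* [A] is a set of unit triangles, standing for the region they cover. *)
Definition rhombus_tiling A (T : {set {set tri n}}) : Prop :=
  finset.partition T A /\ (forall P, P \in T -> rhombus P).

(* The unit triangles covering the complement in Delta of the union of [S]. *)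
Definition holey_region (S : {set tri n}) : {set tri n} :=
  [set t : tri n | (side t == 1) && (t \notin S)]%SET.

Section Points.
Variable R : realType.
Local Open Scope ring_scope.

(* The closed triangle, as a set of points of the plane. *)
Definition points t : set (R * R) :=
  let: (x, y, k) := ((xcoord t)%:R, (ycoord t)%:R, (side t)%:R) : R * R * R in
  if upward t
  then [set p | [/\ x <= p.1, y <= p.2 & p.1 + p.2 <= x + y + k]]%classic
  else [set p | [/\ p.1 <= x, p.2 <= y & x + y - k <= p.1 + p.2]]%classic.

Definition contained s t : Prop := (points s `<=` points t)%classic.

Definition meet_in_point s t : Prop :=
  exists p : R * R, (points s `&` points t = [set p])%classic.

(* [t] is the smallest upward triangle containing [s1] and [s2]. *)
Definition is_join s1 s2 t : Prop :=
  [/\ upward t, contained s1 t, contained s2 t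
    & forall t', upward t' -> contained s1 t' -> contained s2 t' ->
        contained t t'].

Definition spread_out (S : {set tri n}) : Prop :=
  [/\ #|S| = n,
      forall s, s \in S -> upward s /\ side s = 1%N
    & forall t, upward t ->
        (#|[set s in S | `[< contained s t >]]%SET| <= side t)%N].

Definition replace_step A B : Prop :=
  exists s1 s2 t, [/\ s1 \in A, s2 \in A, meet_in_point s1 s2, is_join s1 s2 t
                    & B = (t |: (A :\ s1 :\ s2))%SET].

Definition reduces_to : {set tri n} -> {set tri n} -> Prop :=
  clos_refl_trans {set tri n} replace_step.

End Points.
End Triangles.

(* Main.v *)
Require Import Defs.
From mathcomp Require Import all_boot reals zify.
From Stdlib Require Import Relation_Operators Operators_Properties.

Set Implicit Arguments.
Unset Strict Implicit.
Unset Printing Implicit Defensive.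

Local Open Scope nat_scope.

(** A triangle is recorded by its box: the minima of x and y and the maximum of
    x + y.  Containment, join and meet of upward triangles are computed boxwise, a
    downward unit triangle d is adjacent to an upward one u iff the box of u lies in
    that of d, and a tiling is a perfect matching of the downward unit triangles
    with the upward ones outside S.

    Along a reduction every current triangle t contains exactly (side t) elements of
    S, different ones do not overlap, and t minus S has exactly one tiling, to which
    every tiling of Delta restricts: when t1 and t2 meet in one point, the rest of
    their join is a union of two parallelograms which can only be tiled in one way.

    Conversely, if no two current triangles touch, a downward triangle d outside all
    of them has at most one of its three neighbours inside one of them, hence a free
    neighbour other than its partner.  Following such neighbours yields an alternating
    cycle, thus a second tiling; so there is no such d, and only Delta remains. *)

(** * Boxes of grid triangles, adjacency and joins *)

Section Boxes.
Variable n : nat.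
Implicit Types (s t u d : tri n) (A B : {set tri n}).

Definition xmin t := if upward t then xcoord t else xcoord t - side t.
Definition ymin t := if upward t then ycoord t else ycoord t - side t.
Definition smax t :=
  if upward t then xcoord t + ycoord t + side t else xcoord t + ycoord t.

Lemma tri_box t :
  [/\ 0 < side t,
      smax t = xmin t + ymin t + (if upward t then side t else (side t).*2)
    & smax t <= n].
Proof.
case: t => [[[[b x] y] k] wf]; rewrite /xmin /ymin /smax /upward /side /xcoord /ycoord /=.
by move: wf => /=; case: b => /andP[k0 H]; split=> //; lia.
Qed.

Lemma tri_eq s t : upward s = upward t -> xmin s = xmin t -> ymin s = ymin t ->
  smax s = smax t -> s = t.
Proof.
case: s t => [[[[b x] y] k] wf] [[[[b' x'] y'] k'] wf'].
rewrite /xmin /ymin /smax /upward /side /xcoord /ycoord /= => eb.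
move: wf wf'; rewrite /= -eb => wf wf' ex ey es.
apply: val_inj => /=; congr (_, _, _, _) => //; apply: val_inj => /=;
  by case: b eb wf wf' ex ey es => _ /=; lia.
Qed.

(** The box of a downward unit triangle is the upward triangle of side 2 formed by it and its three
    neighbours. So one relation serves both as containment in an upward triangle and as adjacency of
    an upward unit triangle to a downward one, and by transitivity an upward triangle containing [d]
    contains the neighbours of [d]. *)
Definition sub s t := [&& xmin t <= xmin s, ymin t <= ymin s & smax s <= smax t].

Lemma sub_refl t : sub t t.
Proof. by rewrite /sub !leqnn. Qed.

Lemma sub_trans t s u : sub s t -> sub t u -> sub s u.
Proof. by rewrite /sub; lia. Qed.

Definition up1 u := upward u && (side u == 1).
Definition dn1 d := ~~ upward d && (side d == 1).

Lemma up1_box u : up1 u -> smax u = xmin u + ymin u + 1 /\ smax u <= n.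
Proof. by case/andP => U /eqP k1; have [_ ->] := tri_box u; rewrite U k1. Qed.

Lemma dn1_box d : dn1 d -> smax d = xmin d + ymin d + 2 /\ smax d <= n.
Proof. by case/andP => /negbTE U /eqP k1; have [_ ->] := tri_box d; rewrite U k1. Qed.

Lemma up1_upward u : up1 u -> upward u.
Proof. by case/andP. Qed.

Lemma up1_neq_dn1 u d : up1 u -> dn1 d -> u != d.
Proof. by move=> /andP[U _] /andP[D _]; apply: contraTneq U => ->. Qed.

Lemma up1_eq u u' : up1 u -> up1 u' -> xmin u = xmin u' -> ymin u = ymin u' ->
  u = u'.
Proof.
move=> U U' ex ey; have [[e _] [e' _]] := (up1_box U, up1_box U').
by case/andP: U U' => U _ /andP[U' _]; apply: tri_eq; rewrite ?U ?U' //; lia.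
Qed.

Lemma dn1_eq u u' : dn1 u -> dn1 u' -> xmin u = xmin u' -> ymin u = ymin u' ->
  u = u'.
Proof.
move=> U U' ex ey; have [[e _] [e' _]] := (dn1_box U, dn1_box U').
case/andP: U U' => /negbTE U _ /andP[/negbTE U' _].
by apply: tri_eq; rewrite ?U ?U' //; lia.
Qed.

Lemma exists_up x y k : 0 < k -> x + y + k <= n ->
  exists t, [/\ upward t, side t = k, xmin t = x, ymin t = y & smax t = x + y + k].
Proof.
move=> k0 le_n.
have [hx hy hk] : [/\ x < n.+1, y < n.+1 & k < n.+1] by split; lia.
have wf : @wf_tri n (true, Ordinal hx, Ordinal hy, Ordinal hk).
  by rewrite /wf_tri /= k0.
by exists (Tri wf).
Qed.

Lemma exists_up1 x y : x + y < n ->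
  exists u, [/\ up1 u, xmin u = x, ymin u = y & smax u = x + y + 1].
Proof.
move=> lt_n; have [||u [U k ex ey es]] := @exists_up x y 1 => //; first by lia.
by exists u; rewrite /up1 U k.
Qed.

Lemma exists_dn1 x y : x + y + 1 < n ->
  exists d, [/\ dn1 d, xmin d = x, ymin d = y & smax d = x + y + 2].
Proof.
move=> lt_n.
(* A downward triangle is encoded by the vertex where both coordinates are maximal, hence the shift
   by one. *)
have [hx hy hk] : [/\ x.+1 < n.+1, y.+1 < n.+1 & 1 < n.+1] by split; lia.
have wf : @wf_tri n (false, Ordinal hx, Ordinal hy, Ordinal hk).
  by rewrite /wf_tri /=; lia.
exists (Tri wf); split => //; rewrite /xmin /ymin /smax /xcoord /ycoord /side /=; lia.
Qed.

(** The sum has the shape to which the count of common vertices unfolds. *)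
Lemma two_of_three (a b c : bool) :
  a + (b + (c + 0)) == 2 -> [|| a && b, a && c | b && c].
Proof. by case: a b c => [] [] []. Qed.

Lemma share_edgeE s t : side s = 1 -> side t = 1 -> s != t ->
  share_edge s t = [|| [&& up1 s, dn1 t & sub s t] | [&& up1 t, dn1 s & sub t s]].
Proof.
move=> ks kt ne.
have ne' : upward s = upward t -> ~ (xcoord s = xcoord t /\ ycoord s = ycoord t).
  move=> eU [ex ey]; case/eqP: ne; apply: tri_eq => //;
  by rewrite /xmin /ymin /smax ?ks ?kt ?ex ?ey ?eU.
have [wfs wft] := (tri_wf s, tri_wf t).
rewrite /share_edge size_filter /vertices ks kt /up1 /dn1 ks kt /sub /xmin /ymin /smax ks kt.
(* Positive coordinates make the truncated subtractions in the vertices of a downward unit triangle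
   genuine. *)
have {wfs} : if upward s then true else (0 < xcoord s) && (0 < ycoord s).
  move: wfs ks; rewrite /upward /xcoord /ycoord /side.
  by case: (s) => [[[[b x] y] k] wf] /=; case: (b) => /=; lia.
have {wft} : if upward t then true else (0 < xcoord t) && (0 < ycoord t).
  move: wft kt; rewrite /upward /xcoord /ycoord /side.
  by case: (t) => [[[[b x] y] k] wf] /=; case: (b) => /=; lia.
move: ne'; case: (upward s); case: (upward t) => /= ne';
  rewrite ?inE ?xpair_eqE; move: ne';
  move: (xcoord s) (ycoord s) (xcoord t) (ycoord t) => x y x' y' ne' wt ws.
- apply/negbTE/negP => /two_of_three /or3P[] /andP[];
  rewrite ?andbT; move: (ne' erefl); lia.
- apply/idP/idP.
    move=> /two_of_three /or3P[] /andP[]; lia.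
  case: x' y' wt {ne'} => [|x'] [|y'] //= _ H.
  (* The three positions of an upward neighbour, where [x'] and [y'] are now the minima of the
     downward triangle. *)
  have : x' = x /\ (y' = y \/ y'.+1 = y) \/ x' = x.-1 /\ 0 < x /\ y' = y by lia.
  rewrite ?subn1 ?addn1 /=.
  by move=> [[-> [->|<-]]|[-> [x0 ->]]]; rewrite ?prednK // ?eqxx /=; lia.
- apply/idP/idP.
    move=> /two_of_three /or3P[] /andP[]; lia.
  case: x y ws {ne'} => [|x] [|y] //= _ H.
  have : x = x' /\ (y = y' \/ y.+1 = y') \/ x = x'.-1 /\ 0 < x' /\ y = y' by lia.
  rewrite ?subn1 ?addn1 /=.
  by move=> [[-> [->|<-]]|[-> [x0 ->]]]; rewrite ?prednK // ?eqxx /=; lia.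
- apply/negbTE/negP => /two_of_three /or3P[] /andP[];
  rewrite ?andbT; move: (ne' erefl); lia.
Qed.

Lemma rhombusP (P : {set tri n}) :
  rhombus P <-> exists d u, [/\ dn1 d, up1 u, sub u d & P = [set d; u]].
Proof.
split=> [[s [t [ks kt ne]]]|[d [u [D U ud ->]]]].
  rewrite share_edgeE // => /orP[] /and3P[U D ud] ->.
    by exists t, s; rewrite setUC.
  by exists s, t.
exists u, d; rewrite setUC; have ne := up1_neq_dn1 U D.
case/andP: (U) (D) => _ /eqP ku /andP[_ /eqP kd].
by split; rewrite // share_edgeE // U D ud.
Qed.

Lemma set2_dn_up d u d' u' : dn1 d -> up1 u -> dn1 d' -> up1 u' ->
  [set d; u] = [set d'; u'] -> d = d' /\ u = u'.
Proof.
move=> D U D' U' e.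
have: d \in [set d'; u'] by rewrite -e !inE eqxx.
have: u \in [set d'; u'] by rewrite -e !inE eqxx orbT.
by rewrite !inE (negbTE (up1_neq_dn1 U D')) eq_sym
  [d == u']eq_sym (negbTE (up1_neq_dn1 U' D)) orbF => /eqP -> /eqP ->.
Qed.

(** The intersection of two upward triangles is cut out by the larger minima and the smaller
    maximum; it is a point when the resulting box has side 0. *)
Definition touch t1 t2 := minn (smax t1) (smax t2) =
  maxn (xmin t1) (xmin t2) + maxn (ymin t1) (ymin t2).

(** No common interior; touching is allowed. *)
Definition apart t1 t2 := minn (smax t1) (smax t2) <=
  maxn (xmin t1) (xmin t2) + maxn (ymin t1) (ymin t2).

Definition join t1 t2 t := [/\ upward t, xmin t = minn (xmin t1) (xmin t2),
  ymin t = minn (ymin t1) (ymin t2) & smax t = maxn (smax t1) (smax t2)].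

Definition step A B := exists t1 t2 t, [/\ t1 \in A, t2 \in A, touch t1 t2,
  join t1 t2 t & B = t |: (A :\ t1 :\ t2)].

Lemma up_box t : upward t ->
  [/\ 0 < side t, smax t = xmin t + ymin t + side t & smax t <= n].
Proof. by move=> U; have := tri_box t; rewrite U. Qed.

Lemma exists_join t1 t2 : upward t1 -> upward t2 -> exists t, join t1 t2 t.
Proof.
move=> /up_box[? ? ?] /up_box[? ? ?].
have [||t [U _ ex ey es]] := @exists_up (minn (xmin t1) (xmin t2))
  (minn (ymin t1) (ymin t2)) (maxn (smax t1) (smax t2) -
  minn (xmin t1) (xmin t2) - minn (ymin t1) (ymin t2)); [lia | lia |].
by exists t; split => //; lia.
Qed.

Lemma apartC t1 t2 : apart t1 t2 -> apart t2 t1.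
Proof. by rewrite /apart; lia. Qed.

Lemma apart_up1 t1 t2 u : apart t1 t2 -> up1 u -> sub u t1 -> sub u t2 -> False.
Proof. by rewrite /apart /sub => H /up1_box; lia. Qed.

Lemma apart_dn1 t1 t2 u : apart t1 t2 -> dn1 u -> sub u t1 -> sub u t2 -> False.
Proof. by rewrite /apart /sub => H /dn1_box; lia. Qed.

End Boxes.

(** * Forced gluing in the join of two touching triangles *)

Section Touch.
Variables (n : nat) (t1 t2 t : tri n).
Hypotheses (t12 : touch t1 t2) (tJ : join t1 t2 t).
Implicit Types s u d : tri n.

Lemma touch_apart : apart t1 t2.
Proof. by rewrite /apart t12. Qed.

Lemma sub_joinl : sub t1 t.
Proof. by case: tJ => _; rewrite /sub; lia. Qed.

Lemma sub_joinr : sub t2 t.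
Proof. by case: tJ => _; rewrite /sub; lia. Qed.

Hypotheses (U1 : upward t1) (U2 : upward t2).

(** The minimum and maximum of two numbers add up to their sum, so the sides of the join and of the
    intersection add up to those of [t1] and [t2]; the intersection has side 0. *)
Lemma side_join : side t = side t1 + side t2.
Proof.
case: tJ => /up_box[_ ? _] ? ? ?; move: t12; rewrite /touch.
by have [[_ ? _] [_ ? _]] := (up_box U1, up_box U2); lia.
Qed.

Definition region s := [&& sub s t, ~~ sub s t1 & ~~ sub s t2].

Definition px := maxn (xmin t1) (xmin t2).
Definition py := maxn (ymin t1) (ymin t2).
Definition pz := minn (smax t1) (smax t2).

(* In the join, outside t1 and t2, exactly one barycentric coordinate reaches that
   of the common point (px, py) of t1 and t2. *)
Lemma region_cases s : region s -> up1 s || dn1 s ->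
  [\/ [/\ px <= xmin s, ymin s < py & pz < smax s],
      [/\ xmin s < px, py <= ymin s & pz < smax s]
    | [/\ xmin s < px, ymin s < py & smax s <= pz]].
Proof.
move=> rs us.
have {us} : xmin s + ymin s < smax s <= xmin s + ymin s + 2.
  by case/orP: us => [/up1_box|/dn1_box] [-> _]; lia.
(* [s] violates one bound of [t1] and one of [t2]. These concern different coordinates, since [s]
   satisfies the weaker bounds of the join. *)
move=> us; have h : xmin s < px /\ ymin s < py \/ xmin s < px /\ pz < smax s \/
    ymin s < py /\ pz < smax s.
  case: tJ => _; move: rs; rewrite /region /sub /px /py /pz; lia.
(* The third coordinate is then determined, because the box of a unit triangle has side at most
   2. *)
have e : pz = px + py := t12.
case: h => [[? ?]|[[? ?]|[? ?]]]; [constructor 3|constructor 2|constructor 1];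
  by split=> //; lia.
Qed.

(* d is glued to its neighbour in the direction of that coordinate. *)
Definition forced d u := sub u d &&
  [|| (px <= xmin d) && (xmin u == (xmin d).+1),
      (py <= ymin d) && (ymin u == (ymin d).+1)
    | (smax d <= pz) && ((smax u).+1 == smax d)].

Lemma region_dn d : region d -> dn1 d -> exists u, up1 u && forced d u.
Proof.
move=> rd D; have [? ?] := dn1_box D.
have [] := region_cases rd; rewrite ?D ?orbT // => -[? ? ?].
- have [|u [U ? ? ?]] := @exists_up1 n (xmin d).+1 (ymin d); first by lia.
  by exists u; rewrite U /forced /sub; lia.
- have [|u [U ? ? ?]] := @exists_up1 n (xmin d) (ymin d).+1; first by lia.
  by exists u; rewrite U /forced /sub; lia.
- have [|u [U ? ? ?]] := @exists_up1 n (xmin d) (ymin d); first by lia.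
  by exists u; rewrite U /forced /sub; lia.
Qed.

(** Step back from [u] by one towards the common point. The two other inequalities and
    [pz = px + py] leave room for this step, so [d] stays in the same case of [region_cases]. *)
Lemma region_up u : region u -> up1 u -> exists d, [/\ dn1 d, region d & forced d u].
Proof.
move=> ru U; have [? ?] := up1_box U; have e : pz = px + py := t12.
have [_ _ le_n] := up_box U1; have le_pz : pz <= n by rewrite /pz geq_min le_n.
have := region_cases ru; rewrite U => /(_ erefl) -[] -[c1 c2 c3].
- have [|d [D ex ey es]] := @exists_dn1 n (xmin u).-1 (ymin u); first by lia.
  exists d; rewrite D /forced /sub; split=> //; last by lia.
  move: ru c1; case: tJ => _; rewrite /region /sub.
  have : px <= xmin d by lia.
  have -> : smax d = smax u by lia.
  rewrite ey /px; lia.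
- have [|d [D ex ey es]] := @exists_dn1 n (xmin u) (ymin u).-1; first by lia.
  exists d; rewrite D /forced /sub; split=> //; last by lia.
  move: ru c2; case: tJ => _; rewrite /region /sub.
  have : py <= ymin d by lia.
  have -> : smax d = smax u by lia.
  rewrite ex /py; lia.
- have [|d [D ex ey es]] := @exists_dn1 n (xmin u) (ymin u); first by lia.
  exists d; rewrite D /forced /sub; split=> //; last by lia.
  move: ru c3; case: tJ => _; rewrite /region /sub.
  have : smax d <= pz by lia.
  rewrite ex ey /pz; lia.
Qed.

Lemma forced_cases d u : dn1 d -> up1 u -> region d -> forced d u ->
  [\/ [/\ px <= xmin d, ymin d < py, pz < smax d
        & [/\ xmin u = (xmin d).+1, ymin u = ymin d & smax u = smax d]],
      [/\ xmin d < px, py <= ymin d, pz < smax d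
        & [/\ xmin u = xmin d, ymin u = (ymin d).+1 & smax u = smax d]]
    | [/\ xmin d < px, ymin d < py, smax d <= pz
        & [/\ xmin u = xmin d, ymin u = ymin d & (smax u).+1 = smax d]]].
Proof.
move=> D U rd; have [[? _] [? _]] := (up1_box U, dn1_box D).
have := region_cases rd; rewrite D orbT /forced /sub => /(_ erefl) -[] -[? ? ?] F;
  [constructor 1 | constructor 2 | constructor 3]; by do 2 split => //; lia.
Qed.

Lemma forced_uniq d u u' : dn1 d -> up1 u -> up1 u' -> region d ->
  forced d u -> forced d u' -> u = u'.
Proof.
move=> D U U' rd F F'; apply: up1_eq => //.
  by case: (forced_cases D U rd F) (forced_cases D U' rd F')
    => -[? ? ? [? ? ?]] [] [? ? ? [? ? ?]]; lia.
by case: (forced_cases D U rd F) (forced_cases D U' rd F')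
  => -[? ? ? [? ? ?]] [] [? ? ? [? ? ?]]; lia.
Qed.

(** Passing from [d] to [u] changes only the coordinate that already meets the bounds of both [t1]
    and [t2], so the violated bounds stay violated. *)
Lemma forced_region d u : dn1 d -> up1 u -> region d -> forced d u -> region u.
Proof.
move=> D U rd F; move: rd (forced_cases D U rd F); rewrite /region /sub.
case: tJ => _ -> -> -> rd [] [c1 c2 c3 [ex ey es]].
- by move: rd c1; rewrite ex ey es /px; lia.
- by move: rd c2; rewrite ex ey es /py; lia.
- by move: rd c3; rewrite ex ey -es /pz; lia.
Qed.

(** [u] lies in the same case of [region_cases] as [d], and the cases exclude one another; so [u]
    tells the direction in which to go back. *)
Lemma forced_inj d d' u : dn1 d -> dn1 d' -> up1 u -> region d -> region d' ->
  forced d u -> forced d' u -> d = d'.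
Proof.
move=> D D' U rd rd' F F'.
have [[? _] [? _]] := (dn1_box D, dn1_box D').
have [? _] := up1_box U; have e : pz = px + py := t12.
apply: dn1_eq => //.
  by case: (forced_cases D U rd F) (forced_cases D' U rd' F')
    => -[? ? ? [? ? ?]] [] [? ? ? [? ? ?]]; lia.
by case: (forced_cases D U rd F) (forced_cases D' U rd' F')
  => -[? ? ? [? ? ?]] [] [? ? ? [? ? ?]]; lia.
Qed.

End Touch.

(** * Rhombus tilings as matchings *)

Section Matchings.
Variables (n : nat) (hn : 0 < n) (S : {set tri n}).
Hypothesis S_up1 : forall s, s \in S -> up1 s.
Implicit Types (s t u d : tri n) (f : tri n -> tri n) (T : {set {set tri n}}).

Lemma sub_whole t : sub t (whole hn).
Proof. by have [_ _] := tri_box t; rewrite /sub /xmin /ymin /smax. Qed.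

(* The dual form of a rhombus tiling of t minus S: each downward unit triangle d
   of t is glued to f d. *)
Definition matching t f :=
  [/\ forall d, dn1 d -> sub d t -> [/\ up1 (f d), sub (f d) d & f d \notin S],
      forall d d', dn1 d -> dn1 d' -> sub d t -> sub d' t -> f d = f d' -> d = d'
    & forall u, up1 u -> sub u t -> u \notin S ->
        exists d, [/\ dn1 d, sub d t & f d = u]].

Definition tiles f : {set {set tri n}} := [set [set d; f d] | d in [pred d | dn1 d]].

Lemma dn1_notin_S d : dn1 d -> d \notin S.
Proof. by move=> D; apply/negP => /S_up1 /up1_neq_dn1 /(_ D); rewrite eqxx. Qed.

Lemma side1 t : side t = 1 -> up1 t || dn1 t.
Proof. by rewrite /up1 /dn1 => ->; case: (upward t). Qed.

Lemma side_dn1 d : dn1 d -> side d = 1. Proof. by case/andP => _ /eqP. Qed.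
Lemma side_up1 d : up1 d -> side d = 1. Proof. by case/andP => _ /eqP. Qed.

Lemma tiling_of_matching f :
  matching (whole hn) f -> rhombus_tiling (holey_region S) (tiles f).
Proof.
move=> [fP f_inj f_surj]; split; last first.
  move=> P /imsetP[d D ->]; have [U ud _] := fP d D (sub_whole d).
  by apply/rhombusP; exists d, (f d).
apply/and3P; split.
- apply/eqP/setP => x; apply/bigcupP/idP => [[_ /imsetP[d D ->]]|].
    have [U _ fS] := fP d D (sub_whole d).
    rewrite !inE => /orP[] /eqP ->; first by rewrite side_dn1 ?dn1_notin_S.
    by rewrite side_up1.
  rewrite inE => /andP[/eqP /side1 /orP[U|D]] xS.
    have [d [D _ <-]] := f_surj x U (sub_whole x) xS.
    by exists [set d; f d]; rewrite ?inE ?eqxx ?orbT //; apply: imset_f.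
  by exists [set x; f x]; rewrite ?inE ?eqxx //; apply: imset_f.
- apply/trivIsetP => _ _ /imsetP[d D ->] /imsetP[d' D' ->].
  have [[U _ _] [U' _ _]] := (fP d D (sub_whole d), fP d' D' (sub_whole d')).
  apply: contraR => /pred0Pn[x] /andP[]; rewrite !inE.
  case/orP=> /eqP -> /orP[] /eqP e; first by rewrite e.
  - by have := up1_neq_dn1 U' D; rewrite e eqxx.
  - by have := up1_neq_dn1 U D'; rewrite e eqxx.
  - by rewrite (f_inj d d') ?sub_whole.
- by apply/imsetP => [[d _ /setP/(_ d)]]; rewrite !inE eqxx.
Qed.

Lemma matching_of_tiling T : rhombus_tiling (holey_region S) T ->
  exists2 f, matching (whole hn) f & T = tiles f.
Proof.
move=> [/and3P[/eqP covT /trivIsetP trivT _] rhT].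
have block x : side x = 1 -> x \notin S ->
    exists d u, [/\ dn1 d, up1 u, sub u d & [set d; u] \in T] /\ (x = d \/ x = u).
  move=> kx xS; have : x \in finset.cover T by rewrite covT inE kx.
  case/bigcupP=> P PT; have /rhombusP[d [u [D U ud eP]]] := rhT P PT.
  rewrite eP !inE => xP; exists d, u; rewrite -eP; split => //.
  by case/orP: xP => /eqP; [left | right].
(* The default is never reached for a downward unit [d]: it is not in [S], so some rhombus of [T]
   covers it. *)
pose f d := odflt d [pick u | up1 u && ([set d; u] \in T)].
have fP d : dn1 d -> up1 (f d) && ([set d; f d] \in T).
  move=> D; rewrite /f; case: pickP => //= none.
  have [d' [u [[D' U _ duT]] []]] := block d (side_dn1 D) (dn1_notin_S D) => e.
    by have := none u; rewrite U e duT.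
  by have := up1_neq_dn1 U D; rewrite e eqxx.
have meet P Q x : P \in T -> Q \in T -> x \in P -> x \in Q -> P = Q.
  move=> PT QT xP xQ; apply/eqP; apply: contraTT xP => ne.
  by have := trivT P Q PT QT ne; rewrite disjoint_sym => /disjointFr ->.
have f_uniq d u : dn1 d -> up1 u -> [set d; u] \in T -> u = f d.
  move=> D U duT; have /andP[U' duT'] := fP d D.
  have [] // := @set2_dn_up n d u d (f d) => //.
  by apply: (meet _ _ d) => //; rewrite !inE eqxx.
exists f; first split.
- move=> d D _; have /andP[U duT] := fP d D.
  have /rhombusP[d' [u' [D' U' ud e]]] := rhT _ duT.
  have [ed eu] := set2_dn_up D U D' U' e; split; rewrite // ?eu ?ed //.
  have : u' \in finset.cover T.
    by apply/bigcupP; exists [set d; f d] => //; rewrite e !inE eqxx orbT.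
  by rewrite covT inE => /andP[].
- move=> d d' D D' _ _ e; have [/andP[U duT] /andP[U' duT']] := (fP d D, fP d' D').
  have /set2_dn_up [] // : [set d; f d] = [set d'; f d'].
  by apply: (meet _ _ (f d)); rewrite // !inE ?e eqxx orbT.
- move=> u U _ uS; have [d [u' [[D U' _ duT] []]]] := block u (side_up1 U) uS => e.
    by have := up1_neq_dn1 U D; rewrite e eqxx.
  by exists d; rewrite D sub_whole e -(f_uniq d u').
apply/setP => P; apply/idP/imsetP => [PT|[d D ->]]; last by case/andP: (fP d D).
have /rhombusP[d [u [D U ud e]]] := rhT P PT.
by exists d => //; rewrite e (f_uniq d u) -?e.
Qed.

(** A matching has arbitrary values away from downward unit triangles, so matchings are compared on
    these only. *)
Lemma tiles_inj f f' : matching (whole hn) f -> matching (whole hn) f' ->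
  tiles f = tiles f' -> forall d, dn1 d -> f d = f' d.
Proof.
move=> [fP _ _] [fP' _ _] e d D; have [U _ _] := fP d D (sub_whole d).
have /imsetP[d' D' e'] : [set d; f d] \in tiles f' by rewrite -e; apply: imset_f.
have [U' _ _] := fP' d' D' (sub_whole d').
by have [-> ->] := set2_dn_up D U D' U' e'.
Qed.

Lemma eq_tiles f f' : (forall d, dn1 d -> f d = f' d) -> tiles f = tiles f'.
Proof. by move=> e; apply: eq_in_imset => d D; rewrite e. Qed.

End Matchings.

(** * The invariant of a reduction *)

Section Steps.
Variables (n : nat) (hn : 0 < n) (S : {set tri n}).
Hypothesis S_up1 : forall s, s \in S -> up1 s.
Hypothesis spread : forall t, upward t -> #|[set s in S | sub s t]| <= side t.
Implicit Types (s t u d : tri n) (f : tri n -> tri n) (A B : {set tri n}).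

Definition holes t := [set s in S | sub s t].

(** With the bound [spread] this is equality: [t] contains as many elements of [S] as allowed. *)
Definition saturated t := upward t /\ side t <= #|holes t|.

(* Every matching of Delta restricts to a matching of t. *)
Definition closed t := forall f, matching S (whole hn) f ->
  forall d, dn1 d -> sub (f d) t -> sub d t.

Definition rigid t := forall f f', matching S (whole hn) f ->
  matching S (whole hn) f' -> forall d, dn1 d -> sub d t -> f d = f' d.

Section Join.
Variables t1 t2 t : tri n.
Hypotheses (sat1 : saturated t1) (sat2 : saturated t2).
Hypotheses (t12 : touch t1 t2) (tJ : join t1 t2 t).

Let U1 : upward t1. Proof. by case: sat1. Qed.
Let U2 : upward t2. Proof. by case: sat2. Qed.

Lemma card_holes_join : #|holes t1 :|: holes t2| = #|holes t1| + #|holes t2|.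
Proof.
rewrite cardsU [_ :&: _](_ : _ = set0) ?cards0 ?subn0 //.
apply/setP => s; rewrite !inE; apply/negP => /andP[/andP[sS s1] /andP[_ s2]].
exact: apart_up1 (touch_apart t12) (S_up1 sS) s1 s2.
Qed.

(** By counting: [spread] allows [t] at most [side t1 + side t2] elements of [S], and [t1] and [t2]
    already supply that many. So none lies in the region between them. *)
Lemma holes_join : holes t = holes t1 :|: holes t2.
Proof.
apply/esym/eqP; rewrite eqEcard; apply/andP; split.
  apply/subsetP => s; rewrite !inE => /orP[] /andP[-> /sub_trans->] //;
  [exact: (sub_joinl tJ) | exact: (sub_joinr tJ)].
case: tJ => /spread le_t _ _ _; apply: leq_trans le_t _.
by rewrite card_holes_join (side_join t12 tJ U1 U2) leq_add //; [case: sat1 | case: sat2].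
Qed.

Lemma saturated_join : saturated t.
Proof.
split; first by case: tJ.
by rewrite holes_join card_holes_join (side_join t12 tJ U1 U2) leq_add //;
  [case: sat1 | case: sat2].
Qed.

(* By submodularity two overlapping saturated triangles share an element of S. *)
Lemma apart_join t3 : saturated t3 -> apart t1 t3 -> apart t2 t3 -> apart t t3.
Proof.
move=> [U3 sat3] a1 a2; rewrite /apart leqNgt; apply/negP => ov.
have [U satt] := saturated_join.
have [v [Uv ex ey es]] := exists_join U U3.
(* An overlap of positive side makes [side v] smaller than [side t + side t3], which contradicts
   this bound once the two sets of holes are disjoint. *)
have: #|holes t :|: holes t3| <= side v.
  apply: leq_trans (spread Uv); apply/subset_leq_card/subsetP => s.
  by rewrite !inE => /orP[] /andP[-> /=]; rewrite /sub; lia.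
rewrite cardsU [_ :&: _](_ : _ = set0) ?cards0 ?subn0.
  have [_ ? _] := up_box U; have [_ ? _] := up_box U3.
  have [_ ? _] := up_box Uv; lia.
rewrite holes_join; apply/setP => s; rewrite !inE; apply/negP.
case/andP=> /orP[] /andP[sS s12] /andP[_ s3].
  exact: apart_up1 a1 (S_up1 sS) s12 s3.
exact: apart_up1 a2 (S_up1 sS) s12 s3.
Qed.

Hypotheses (cl1 : closed t1) (cl2 : closed t2).

(* If d were not glued to its forced neighbour, then another downward triangle of
   the region, closer to the common point, would not be either. *)
Lemma matching_forced f d : matching S (whole hn) f -> dn1 d -> region t1 t2 t d ->
  forced t1 t2 d (f d).
Proof.
move=> mf; have [fP f_inj _] := mf.
(* In the region at most one summand is nonzero, by truncation: the distance to the common point in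
   the coordinate singled out by [region_cases]. *)
pose pot d := (xmin d - px t1 t2) + (ymin d - py t1 t2) + (pz t1 t2 - smax d).
have [m] := ubnP (pot d); elim: m d => // m IH d lt_m D rd.
have [U ud _] := fP d D (sub_whole hn d).
have ru : region t1 t2 t (f d).
  move: rd; rewrite /region => /and3P[dt d1 d2].
  rewrite (sub_trans ud dt) (contra _ d1) ?(contra _ d2) //;
  [exact: cl2 | exact: cl1].
have [d' [D' rd' F']] := region_up t12 tJ U1 U2 ru U.
have [e|ne] := eqVneq d' d; first by rewrite -{1}e.
(* [d], [f d] and [d'] lie in the same case. As [f d] is not the forced neighbour of [d], it agrees
   with [d] in the singled-out coordinate, whereas [d'] is one step closer. *)
have lt_pot : pot d' < pot d.
  have [? _] := dn1_box D; have [? _] := dn1_box D'; have [? _] := up1_box U.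
  have ne' : ~ (xmin d' = xmin d /\ ymin d' = ymin d).
    by move=> [ex ey]; case/eqP: ne; apply: dn1_eq.
  have := region_cases t12 tJ U1 U2 rd; rewrite D orbT => /(_ erefl) cd.
  move: ud; rewrite /pot /sub => /and3P[ux uy us].
  case: (forced_cases t12 tJ U1 U2 D' U rd' F') => -[? ? ? [? ? ?]].
  - by case: cd => -[? ? ?]; lia.
  - by case: cd => -[? ? ?]; lia.
  - by case: cd => -[? ? ?]; lia.
have F'' := IH d' (leq_trans lt_pot lt_m) D' rd'.
have [U' _ _] := fP d' D' (sub_whole hn d').
have e := forced_uniq t12 tJ U1 U2 D' U U' rd' F' F''.
by rewrite (f_inj d' d) ?sub_whole ?eqxx in ne.
Qed.

Lemma rigid_join : rigid t1 -> rigid t2 -> rigid t.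
Proof.
move=> r1 r2 f f' mf mf' d D dt.
have [d1|d1] := boolP (sub d t1); first exact: r1.
have [d2|d2] := boolP (sub d t2); first exact: r2.
have rd : region t1 t2 t d by rewrite /region dt d1.
have [[fP _ _] [fP' _ _]] := (mf, mf').
have [U _ _] := fP d D (sub_whole hn d); have [U' _ _] := fP' d D (sub_whole hn d).
by apply: (forced_uniq t12 tJ U1 U2 D U U' rd); exact: matching_forced.
Qed.

(** An upward triangle of the region is the forced neighbour of some [d'] of the region, to which
    every matching glues it; injectivity gives [d = d']. *)
Lemma closed_join : closed t.
Proof.
move=> f mf d D ut; have [fP f_inj _] := mf.
have [u1|u1] := boolP (sub (f d) t1).
  exact: sub_trans (cl1 mf D u1) (sub_joinl tJ).
have [u2|u2] := boolP (sub (f d) t2).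
  exact: sub_trans (cl2 mf D u2) (sub_joinr tJ).
have [U _ _] := fP d D (sub_whole hn d).
have [d' [D' rd' F]] : exists d', [/\ dn1 d', region t1 t2 t d' & forced t1 t2 d' (f d)].
  by apply: (region_up t12 tJ U1 U2) => //; rewrite /region ut u1.
have [U' _ _] := fP d' D' (sub_whole hn d').
have e := forced_uniq t12 tJ U1 U2 D' U U' rd' F (matching_forced mf D' rd').
by rewrite (f_inj d d') ?sub_whole //; case/and3P: rd'.
Qed.

(** The given matchings on [t1] and [t2] are completed by the forced gluing on the region, which
    contains no element of [S] by [holes_join]. *)
Lemma matching_join f1 f2 : matching S t1 f1 -> matching S t2 f2 ->
  exists f, matching S t f.
Proof.
move=> [fP1 inj1 surj1] [fP2 inj2 surj2].
have apt := (touch_apart t12).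
pose f0 d := odflt d [pick u | up1 u && forced t1 t2 d u].
have f0P d : dn1 d -> region t1 t2 t d -> up1 (f0 d) && forced t1 t2 d (f0 d).
  move=> D rd; rewrite /f0; case: pickP => //= none.
  by have [u] := region_dn t12 tJ U1 U2 rd D; rewrite none.
pose f d := if sub d t1 then f1 d else if sub d t2 then f2 d else f0 d.
have split d : dn1 d -> sub d t -> [\/ [/\ sub d t1, f d = f1 d & sub (f d) t1],
    [/\ sub d t2, f d = f2 d & sub (f d) t2] |
    [/\ region t1 t2 t d, f d = f0 d & region t1 t2 t (f d)]].
  move=> D dt; rewrite /f; have [d1|d1] := ifPn; last have [d2|d2] := ifPn.
  - by have [_ ud _] := fP1 d D d1; constructor 1; rewrite (sub_trans ud d1).
  - by have [_ ud _] := fP2 d D d2; constructor 2; rewrite (sub_trans ud d2).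
  have rd : region t1 t2 t d by rewrite /region dt d1.
  have /andP[U F] := f0P d D rd.
  by constructor 3; rewrite (forced_region t12 tJ U1 U2 D U rd F).
have nregion1 s : sub s t1 -> ~~ region t1 t2 t s by rewrite /region => ->; rewrite andbF.
have nregion2 s : sub s t2 -> ~~ region t1 t2 t s by rewrite /region => ->; rewrite !andbF.
have fU d : dn1 d -> sub d t -> [/\ up1 (f d), sub (f d) d & f d \notin S].
  move=> D dt; have [[d1 -> _]|[d2 -> _]|[rd -> _]] := split d D dt.
  - exact: fP1.
  - exact: fP2.
  have /andP[U F] := f0P d D rd; split=> //; first by case/andP: F.
  have := forced_region t12 tJ U1 U2 D U rd F; rewrite /region => /and3P[ut u1 u2].
  apply/negP => uS; have : f0 d \in holes t by rewrite inE uS.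
  by rewrite holes_join !inE (negbTE u1) (negbTE u2) !andbF.
exists f; split => //.
- move=> d d' D D' dt dt' e; have [U _ _] := fU d D dt.
  have [] := split d D dt => [] [rd ed ru]; have [] := split d' D' dt' => [] [];
    rewrite -e => rd' ed' ru'.
  + by apply: inj1; rewrite // -ed.
  + by case: (apart_up1 apt U ru ru').
  + by have := nregion1 _ ru; rewrite ru'.
  + by case: (apart_up1 apt U ru' ru).
  + by apply: inj2; rewrite // -ed.
  + by have := nregion2 _ ru; rewrite ru'.
  + by have := nregion1 _ ru'; rewrite ru.
  + by have := nregion2 _ ru'; rewrite ru.
  + have /andP[_ F] := f0P d D rd; have /andP[_ F'] := f0P d' D' rd'.
    by apply: (forced_inj t12 tJ U1 U2 D D' U rd rd'); [rewrite ed | rewrite ed'].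
- move=> u U ut uS; have [u1|u1] := boolP (sub u t1).
    have [d [D d1 <-]] := surj1 u U u1 uS.
    by exists d; rewrite D (sub_trans d1 (sub_joinl tJ)) /f d1.
  have [u2|u2] := boolP (sub u t2).
    have [d [D d2 <-]] := surj2 u U u2 uS.
    exists d; rewrite D (sub_trans d2 (sub_joinr tJ)) /f d2; split => //.
    by case: ifP => // /(apart_dn1 apt D)/(_ d2).
  have [d [D rd F]] : exists d, [/\ dn1 d, region t1 t2 t d & forced t1 t2 d u].
    by apply: (region_up t12 tJ U1 U2); rewrite // /region ut u1.
  have /andP[U0 F0] := f0P d D rd.
  exists d; rewrite D (forced_uniq t12 tJ U1 U2 D U U0 rd F F0) /f.
  by case/and3P: rd => -> /negbTE -> /negbTE ->.
Qed.

End Join.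

(** For the single triangle Delta, the first clause gives existence and uniqueness of a matching.
    The last clause serves the converse: an upward unit triangle outside all members of [A] is not
    in [S]. *)
Definition coherent A :=
  [/\ forall t, t \in A -> [/\ saturated t, closed t, rigid t
        & exists f, matching S t f],
      forall t1 t2, t1 \in A -> t2 \in A -> t1 != t2 -> apart t1 t2
    & forall s, s \in S -> exists2 t, t \in A & sub s t].

(** An upward unit triangle contains no downward one and only itself as upward one, so nothing is to
    be matched in it; it is closed because matchings avoid [S]. *)
Lemma coherent_holes : coherent S.
Proof.
have no_dn s d : up1 s -> dn1 d -> ~~ sub d s.
  by move=> /up1_box[? _] /dn1_box[? _]; rewrite /sub; lia.
have sub_eq s u : up1 s -> up1 u -> sub u s -> u = s.
  move=> Us Uu us; have [[? _] [? _]] := (up1_box Us, up1_box Uu).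
  by apply: up1_eq; move: us; rewrite /sub; lia.
split=> [t tS|t1 t2 /S_up1 U1 /S_up1 U2|s sS]; last first.
- by exists s => //; exact: sub_refl.
- move=> ne; rewrite /apart leqNgt; apply: contra ne => ov; apply/eqP.
  by have [[? _] [? _]] := (up1_box U1, up1_box U2); apply: up1_eq => //; lia.
have U := S_up1 tS; split.
- split; first by case/andP: U.
  rewrite (side_up1 U) card_gt0; apply/set0Pn; exists t.
  by rewrite inE tS sub_refl.
- move=> f [fP _ _] d D; have [U' _ fS] := fP d D (sub_whole hn d).
  by move=> /(sub_eq _ _ U U') e; rewrite e tS in fS.
- by move=> f f' _ _ d D dt; rewrite (negbTE (no_dn _ _ U D)) in dt.
exists id; split=> [d D|d d' D _|u U' ut uS].
- by rewrite (negbTE (no_dn _ _ U D)).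
- by rewrite (negbTE (no_dn _ _ U D)).
- by rewrite (sub_eq _ _ U U' ut) tS in uS.
Qed.

Lemma coherent_step A B : coherent A -> step A B -> coherent B.
Proof.
move=> [tP apA cov] [t1 [t2 [t [A1 A2 t12 tJ ->]]]].
have [sat1 cl1 r1 [f1 m1]] := tP t1 A1; have [sat2 cl2 r2 [f2 m2]] := tP t2 A2.
have apt t3 : t3 \in A :\ t1 :\ t2 -> apart t t3.
  rewrite !inE => /and3P[ne2 ne1 A3]; have [sat3 _ _ _] := tP t3 A3.
  by apply: (apart_join sat1 sat2 t12 tJ) => //; apply: apA => //; rewrite eq_sym.
split=> [t3|t3 t4|s sS].
- rewrite in_setU1 => /orP[/eqP->|]; last by rewrite !inE => /and3P[_ _ /tP].
  split; first exact: saturated_join sat1 sat2 t12 tJ.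
  + exact: closed_join sat1 sat2 t12 tJ cl1 cl2.
  + exact: rigid_join sat1 sat2 t12 tJ cl1 cl2 r1 r2.
  + by have := matching_join sat1 sat2 t12 tJ m1 m2.
- rewrite (in_setU1 t3) (in_setU1 t4) => /orP[/eqP->|A3] /orP[/eqP->|A4].
  + by rewrite eqxx.
  + by move=> _; exact: apt.
  + by move=> _; apply/apartC/apt.
  + by apply: apA; [move: A3 | move: A4]; rewrite !inE => /and3P[].
- have [t3 A3 s3] := cov s sS.
  have [e1|ne1] := eqVneq t3 t1.
    exists t; first by rewrite !inE eqxx.
    by apply: sub_trans (sub_joinl tJ); rewrite -e1.
  have [e2|ne2] := eqVneq t3 t2.
    exists t; first by rewrite !inE eqxx.
    by apply: sub_trans (sub_joinr tJ); rewrite -e2.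
  by exists t3; rewrite // !inE ne1 ne2 A3 orbT.
Qed.

End Steps.

(** * Alternating cycles and rematching *)

(** A minimal nonempty [g]-stable subset works: its image is again stable and nonempty, hence all of
    it. *)
Lemma exists_permuted_subset (T : finType) (D : {set T}) (g : T -> T) :
  D != set0 -> (forall x, x \in D -> g x \in D) ->
  exists C : {set T}, [/\ C \subset D, C != set0 & g @: C = C].
Proof.
move=> D0 gD; pose P (C : {set T}) := (C != set0) && (g @: C \subset C).
have PD : P D by rewrite /P D0; apply/subsetP => _ /imsetP[x xD ->]; apply: gD.
have [C /minsetP[/andP[C0 gC] minC] CD] := minset_exists PD.
exists C; split=> //; apply: minC => //; rewrite /P imset_eq0 C0.
by apply: imsetS.
Qed.

Section Rematch.
Variables (n : nat) (hn : 0 < n) (S : {set tri n}).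
Implicit Types (u d : tri n) (f : tri n -> tri n).

(** Let [g d] be a triangle whose partner [d] can take over. On a set permuted by [g] all partners
    are exchanged at once, and each changes because [g] has no fixed point there. *)
Lemma rematch f (D : {set tri n}) : matching S (whole hn) f ->
  D != set0 -> (forall d, d \in D -> dn1 d) ->
  (forall d, d \in D -> exists d', [/\ d' \in D, d' != d & sub (f d') d]) ->
  exists f', matching S (whole hn) f' /\ exists2 d, dn1 d & f' d != f d.
Proof.
move=> [fP f_inj f_surj] D0 D_dn1 D_next.
pose g d := odflt d [pick d' | [&& d' \in D, d' != d & sub (f d') d]].
have gP d : d \in D -> [/\ g d \in D, g d != d & sub (f (g d)) d].
  move=> /D_next[d' [d'D ne s]]; rewrite /g.
  by case: pickP => [d'' /and3P[]//|/(_ d')]; rewrite d'D ne s.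
have [|C [CD C0 gC]] := exists_permuted_subset D0 (g := g); first by move=> d /gP[].
(* A map of a finite set onto itself is injective. *)
have g_inj : {in C &, injective g} by apply/imset_injP; rewrite gC.
have gPC d : d \in C -> [/\ dn1 (g d), dn1 d, g d \in C, g d != d & sub (f (g d)) d].
  move=> dC; have dD := subsetP CD d dC; have [gD ne s] := gP d dD.
  by split; rewrite ?D_dn1 // -[C]gC imset_f.
have f_eq d d' : dn1 d -> dn1 d' -> f d = f d' -> d = d'.
  by move=> dn dn'; apply: f_inj; rewrite ?sub_whole.
pose f' d := if d \in C then f (g d) else f d.
exists f'; split; last first.
  have /set0Pn[d dC] := C0; have [dng dn _ ne _] := gPC d dC.
  by exists d; rewrite // /f' dC; apply: contra ne => /eqP/f_eq ->.
split=> [d dn _|d d' dn dn' _ _|u U _ uS].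
- rewrite /f'; case: ifP => [dC|_]; last by apply: fP; rewrite ?sub_whole.
  have [dng _ _ _ s] := gPC d dC.
  by have [] := fP (g d) dng (sub_whole hn _).
- rewrite /f'; case: ifPn => dC; case: ifPn => d'C e.
  + have [[dng _ _ _ _] [dng' _ _ _ _]] := (gPC d dC, gPC d' d'C).
    by apply: g_inj => //; apply: f_eq.
  + have [dng _ gdC _ _] := gPC d dC.
    by rewrite -(f_eq _ _ dng dn' e) gdC in d'C.
  + have [dng' _ gdC' _ _] := gPC d' d'C.
    by rewrite (f_eq _ _ dn dng' e) gdC' in dC.
  + exact: f_eq.
- have [d [dn _ <-]] := f_surj u U (sub_whole hn u) uS.
  have [dC|dC] := boolP (d \in C); last first.
    by exists d; rewrite dn sub_whole /f' (negbTE dC).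
  have : d \in g @: C by rewrite gC.
  case/imsetP=> d' d'C e; have [_ dn' _ _ _] := gPC d' d'C.
  by exists d'; rewrite dn' sub_whole /f' d'C e.
Qed.

End Rematch.

(** * A second matching when no two triangles touch *)

Section Progress.
Variables (n : nat) (hn : 0 < n) (S : {set tri n}).
Implicit Types (s t u d : tri n) (f : tri n -> tri n) (A B : {set tri n}).

Definition covered A s := [exists t, (t \in A) && sub s t].

Lemma coveredP A s : reflect (exists2 t, t \in A & sub s t) (covered A s).
Proof.
by apply: (iffP existsP) => [[t /andP[]]|[t tA st]]; exists t; rewrite ?tA.
Qed.

Lemma card_step A t1 t2 t : t1 \in A -> t2 \in A -> t1 != t2 ->
  #|t |: (A :\ t1 :\ t2)| < #|A|.
Proof.
move=> A1 A2 ne; have A2' : t2 \in A :\ t1 by rewrite !inE eq_sym ne.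
rewrite (cardsD1 t1 A) (cardsD1 t2 (A :\ t1)) A1 A2' cardsU1.
by case: (t \notin _); rewrite !add1n ?add0n.
Qed.

Variable A : {set tri n}.
Hypothesis invA : coherent hn S A.

Let satA t : t \in A -> upward t.
Proof. by case: invA => H _ _ /H[[]]. Qed.

Lemma step_of_touch t1 t2 : t1 \in A -> t2 \in A -> touch t1 t2 ->
  exists2 B, step A B & #|B| < #|A|.
Proof.
move=> A1 A2 t12; have [t tJ] := exists_join (satA A1) (satA A2).
exists (t |: (A :\ t1 :\ t2)); first by exists t1, t2, t.
(* A triangle does not touch itself, having positive side. *)
apply: card_step => //; apply/eqP => e.
by have /up_box[? ? _] := satA A1; move: t12; rewrite /touch -e; lia.
Qed.

Hypothesis no_touch : forall t1 t2, t1 \in A -> t2 \in A -> ~ touch t1 t2.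

(** Two neighbours of [d] span the box of [d], so one triangle containing both would contain [d]. If
    they lay in two different triangles, their common vertex would lie in both, and these, being
    apart, would touch. *)
Lemma covered_neighbours d v w : dn1 d -> ~~ covered A d -> up1 v -> up1 w ->
  v != w -> sub v d -> sub w d -> covered A v -> ~~ covered A w.
Proof.
move=> D cd V W ne vd wd /coveredP[t At vt].
apply/negP => /coveredP[t' At' wt'].
have [[? _] [? _]] := (up1_box V, up1_box W); have [? _] := dn1_box D.
have ne' : ~ (xmin v = xmin w /\ ymin v = ymin w).
  by move=> [? ?]; case/eqP: ne; apply: up1_eq.
have [e|net] := eqVneq t t'.
  case/negP: cd; apply/coveredP; exists t => //.
  by move: vd wd vt wt'; rewrite /sub -e; lia.
case: invA => _ /(_ t t' At At' net) ap _; have := no_touch At At'.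
move: ap vd wd vt wt'; rewrite /apart /touch /sub.
have [_ ? _] := up_box (satA At); have [_ ? _] := up_box (satA At'); lia.
Qed.

(* Of the three neighbours of d at most one is covered and one is f d. *)
Lemma free_neighbour f d : matching S (whole hn) f -> dn1 d -> ~~ covered A d ->
  exists u, [/\ up1 u, sub u d, u != f d & ~~ covered A u].
Proof.
move=> [fP _ _] D cd; have [? ?] := dn1_box D.
have [|u1 [U1 x1 y1 s1]] := @exists_up1 n (xmin d) (ymin d); first by lia.
have [|u2 [U2 x2 y2 s2]] := @exists_up1 n (xmin d).+1 (ymin d); first by lia.
have [|u3 [U3 x3 y3 s3]] := @exists_up1 n (xmin d) (ymin d).+1; first by lia.
have [sub1 sub2 sub3] : [/\ sub u1 d, sub u2 d & sub u3 d].
  by rewrite /sub; split; lia.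
have ne12 : u1 != u2 by apply/eqP => e; move: x2; rewrite -e; lia.
have ne13 : u1 != u3 by apply/eqP => e; move: y3; rewrite -e; lia.
have ne23 : u2 != u3 by apply/eqP => e; move: x3; rewrite -e; lia.
have pick2 v w : up1 v -> up1 w -> v != w -> sub v d -> sub w d ->
    v != f d -> w != f d -> exists u, [/\ up1 u, sub u d, u != f d & ~~ covered A u].
  move=> V W ne vd wd nv nw; have [cv|] := boolP (covered A v); last by exists v.
  by exists w; split=> //; exact: (covered_neighbours D cd V W ne vd wd cv).
have [e1|ne1] := eqVneq u1 (f d).
  by apply: (pick2 u2 u3); rewrite // -e1 eq_sym.
have [e2|ne2] := eqVneq u2 (f d).
  by apply: (pick2 u1 u3); rewrite // -e2 eq_sym.
exact: (pick2 u1 u2).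
Qed.

(** Some [t] in [A] has a side in the interior of Delta. A downward triangle [d] across that side is
    uncovered, since a member of [A] containing [d] would also contain its neighbour [u] in [t] and
    thus overlap [t]. *)
Lemma uncovered_dn1 : A != set0 -> A != [set whole hn] ->
  exists2 d, dn1 d & ~~ covered A d.
Proof.
move=> A0 Aw; case: invA => _ apA _.
have across t d u : t \in A -> dn1 d -> ~~ sub d t -> up1 u -> sub u d -> sub u t ->
    ~~ covered A d.
  move=> At D dt U ud ut; apply/negP => /coveredP[t' At' dt'].
  have [e|ne] := eqVneq t t'; first by rewrite e dt' in dt.
  exact: apart_up1 (apA t t' At At' ne) U ut (sub_trans ud dt').
have [t At nt] : exists2 t, t \in A & t != whole hn.
  have /set0Pn[t At] := A0; have [e|] := eqVneq t (whole hn); last by exists t.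
  have: ~~ (A \subset [set whole hn]).
    apply: contra Aw => sA; rewrite eqEsubset sA sub1set -e //.
  by case/subsetPn => t' At'; rewrite inE; exists t'.
have [? ? ?] := up_box (satA At).
have : [|| 0 < xmin t, 0 < ymin t | smax t < n].
  apply: contraR nt; rewrite !negb_or -!leqNgt !leqn0.
  case/and3P=> /eqP ex /eqP ey es; apply/eqP/tri_eq => //; first by rewrite satA.
  by rewrite [RHS](_ : _ = n) //; lia.
case/or3P=> h.
- have [|d [D dx dy ds]] := @exists_dn1 n (xmin t).-1 (ymin t); first by lia.
  have [|u [U ux uy us]] := @exists_up1 n (xmin t) (ymin t); first by lia.
  by exists d => //; apply: (across t d u); rewrite // /sub; lia.
- have [|d [D dx dy ds]] := @exists_dn1 n (xmin t) (ymin t).-1; first by lia.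
  have [|u [U ux uy us]] := @exists_up1 n (xmin t) (ymin t); first by lia.
  by exists d => //; apply: (across t d u); rewrite // /sub; lia.
(* Here [u] is the corner of [t] with the largest y coordinate, and [d] lies across the side where x
   + y is maximal. *)
- have [|d [D dx dy ds]] := @exists_dn1 n (xmin t) (ymin t + side t).-1; first by lia.
  have [|u [U ux uy us]] := @exists_up1 n (xmin t) (ymin t + side t).-1; first by lia.
  by exists d => //; apply: (across t d u); rewrite // /sub; lia.
Qed.

Lemma second_matching f : matching S (whole hn) f -> A != set0 ->
  A != [set whole hn] ->
  exists f', matching S (whole hn) f' /\ exists2 d, dn1 d & f' d != f d.
Proof.
move=> mf A0 Aw; apply: (rematch (D := [set d | dn1 d && ~~ covered A d])) => //.
- by have [d D cd] := uncovered_dn1 A0 Aw; apply/set0Pn; exists d; rewrite inE D.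
- by move=> d; rewrite inE => /andP[].
move=> d; rewrite inE => /andP[D cd].
have [u [U ud ne cu]] := free_neighbour mf D cd.
have [fP _ f_surj] := mf; case: invA => _ _ covS.
have uS : u \notin S by apply: contra cu => /covS; move/coveredP.
have [d' [D' _ e]] := f_surj u U (sub_whole hn u) uS.
exists d'; rewrite inE D' e ud; split=> //; last by apply: contra ne => /eqP <-; rewrite e.
(* The triangle [d'] glued to [u] is uncovered too, as a triangle containing [d'] contains its
   neighbour [u]. *)
apply: contra cu => /coveredP[t At d't]; apply/coveredP; exists t => //.
by rewrite -e; apply: sub_trans d't; have [] := fP d' D' (sub_whole hn d').
Qed.

End Progress.

(** * The equivalence for reductions expressed by boxes *)

Section Main.
Variables (n : nat) (hn : 0 < n) (S : {set tri n}).
Hypothesis S_up1 : forall s, s \in S -> up1 s.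
Hypothesis spread : forall t, upward t -> #|[set s in S | sub s t]| <= side t.
Implicit Types (s t u d : tri n) (f : tri n -> tri n) (A B : {set tri n}).

Definition steps := clos_refl_trans {set tri n} (@step n).

Lemma coherent_steps A B : steps A B -> coherent hn S A -> coherent hn S B.
Proof.
elim=> {A B} [A B AB invA|//|A B C _ IH _ IH' invA]; last exact/IH'/IH.
exact: coherent_step invA AB.
Qed.

(** Induction on the size of [A]: a touching pair allows a step that lowers it, and without such a
    pair any [A] other than Delta alone yields a second tiling. *)
Lemma unique_tiling_steps : S != set0 ->
  (exists! T, rhombus_tiling (holey_region S) T) -> steps S [set whole hn].
Proof.
move=> S0 [T [tT uniqT]]; have [f mf eT] := matching_of_tiling hn S_up1 tT.
suff H m A : coherent hn S A -> #|A| < m -> steps A [set whole hn].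
  by apply: (H #|S|.+1) => //; apply: coherent_holes.
elim: m A => // m IH A invA lt_m.
have [->|Aw] := eqVneq A [set whole hn]; first exact: rt_refl.
have A0 : A != set0.
  have /set0Pn[s sS] := S0; case: invA => _ _ /(_ s sS)[t At _].
  by apply/set0Pn; exists t.
have [|none] := boolP [exists t1 : tri n, exists t2 : tri n, [&& t1 \in A, t2 \in A &
    minn (smax t1) (smax t2) == maxn (xmin t1) (xmin t2) + maxn (ymin t1) (ymin t2)]].
  case/existsP=> t1 /existsP[t2 /and3P[A1 A2 /eqP t12]].
  have [B AB lt] := step_of_touch invA A1 A2 t12.
  apply: (rt_trans _ _ _ B); first exact: rt_step.
  by apply: IH; [exact: coherent_step AB | exact: leq_trans lt lt_m].
have no_touch t1 t2 : t1 \in A -> t2 \in A -> ~ touch t1 t2.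
  move=> A1 A2 t12; case/negP: none; apply/existsP; exists t1; apply/existsP; exists t2.
  by rewrite A1 A2; apply/eqP.
have [f' [mf' [d D]]] := second_matching invA no_touch mf A0 Aw.
suff -> : f' d = f d by rewrite eqxx.
apply: (tiles_inj mf' mf) => //.
by rewrite -eT; apply/esym/uniqT; apply: tiling_of_matching.
Qed.

Lemma steps_unique_tiling : steps S [set whole hn] ->
  exists! T, rhombus_tiling (holey_region S) T.
Proof.
move=> SW; have [tP _ _] := coherent_steps SW (coherent_holes hn S_up1).
have [_ _ rig [f mf]] := tP (whole hn) (set11 _).
exists (tiles f); split; first exact: tiling_of_matching.
move=> T /(matching_of_tiling hn S_up1)[f' mf' ->]; apply: eq_tiles => d D.
by apply: rig => //; apply: sub_whole.
Qed.

End Main.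

(* From sets of points to boxes *)
From mathcomp Require Import all_order all_algebra boolp classical_sets lra.
Import Order.TTheory GRing.Theory Num.Theory.

Section Points.
Variables (R : realType) (n : nat).
Implicit Types (s t : tri n) (A B S : {set tri n}).

Lemma maxn_ler (a b : nat) (r : R) :
  ((maxn a b)%:R <= r)%R = (a%:R <= r)%R && (b%:R <= r)%R.
Proof. by rewrite -!(natr_max, ge_max). Qed.

Lemma ler_minn (a b : nat) (r : R) :
  (r <= (minn a b)%:R)%R = (r <= a%:R)%R && (r <= b%:R)%R.
Proof. by rewrite -!(natr_min, le_min). Qed.

Lemma pointsP t (p : R * R) : upward t -> points t p <->
  [/\ (xmin t)%:R <= p.1, (ymin t)%:R <= p.2 & p.1 + p.2 <= (smax t)%:R]%R.
Proof. by move=> U; rewrite /points /xmin /ymin /smax U !natrD. Qed.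

Lemma containedP s t : upward s -> upward t -> contained R s t <-> sub s t.
Proof.
move=> Us Ut; have [_ es _] := up_box Us; split=> [st|/and3P[x_le y_le s_le] p].
  have corner p : [/\ xmin s <= p.1, ymin s <= p.2 & p.1 + p.2 <= smax s] ->
      [/\ xmin t <= p.1, ymin t <= p.2 & p.1 + p.2 <= smax t].
    rewrite -!(ler_nat R) natrD => /(pointsP (_, _) Us)/st/(pointsP _ Ut) /=.
    by rewrite -natrD !ler_nat.
  (* This vertex attains both [xmin s] and [smax s]; the next one attains [ymin s]. *)
  have [|/= ? _ ?] := corner (xmin s, ymin s + side s); first by rewrite /=; split; lia.
  have [|/= _ ? _] := corner (xmin s, ymin s); first by rewrite /=; split; lia.
  by rewrite /sub; lia.
move=> /(pointsP _ Us)[px py pxy]; apply/(pointsP _ Ut).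
by split; [apply: le_trans px | apply: le_trans py | apply: le_trans pxy _];
  rewrite ler_nat.
Qed.

Lemma meet_in_pointP s t : upward s -> upward t -> meet_in_point R s t <-> touch s t.
Proof.
move=> Us Ut; pose mx := maxn (xmin s) (xmin t).
pose my := maxn (ymin s) (ymin t); pose mz := minn (smax s) (smax t).
have inP (p : R * R) : (@points n R s `&` points t)%classic p <->
    [/\ mx%:R <= p.1, my%:R <= p.2 & p.1 + p.2 <= mz%:R]%R.
  rewrite /mx /my /mz !maxn_ler ler_minn /setI /=.
  split=> [[/(pointsP _ Us)[-> -> ->] /(pointsP _ Ut)[-> -> ->]] //|].
  by move=> [/andP[? ?] /andP[? ?] /andP[? ?]]; split; apply/pointsP.
rewrite /touch -/mx -/my -/mz; split=> [[p ep]|e].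
  have /inP[px py pxy] : (@points n R s `&` points t)%classic p by rewrite ep.
  have le_m : mx + my <= mz.
    by rewrite -(ler_nat R) natrD; apply: le_trans pxy; apply: lerD.
  apply/eqP; rewrite eqn_leq le_m andbT leqNgt; apply/negP => lt_m.
  have in1 : (@points n R s `&` points t)%classic (mx%:R, my%:R)%R.
    by apply/inP; rewrite /= !lexx -natrD ler_nat.
  (* If the box of the intersection had positive side, it would contain this second grid point. *)
  have in2 : (@points n R s `&` points t)%classic (mx.+1%:R, my%:R)%R.
    by apply/inP; rewrite /= lexx -natrD !ler_nat.
  move: in1 in2; rewrite ep /= => <- [/eqP].
  by rewrite eqr_nat => /eqP; lia.
exists (mx%:R, my%:R)%R; apply/seteqP; split=> [[a b] /inP|_ ->] /=; last first.
  by apply/inP; rewrite /= -natrD e.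
rewrite e natrD => -[ax bY ab]; congr (_, _); lra.
Qed.

Lemma is_joinP s1 s2 t : upward s1 -> upward s2 -> is_join R s1 s2 t <-> join s1 s2 t.
Proof.
move=> U1 U2; split=> [[U /(containedP U1 U) s1t /(containedP U2 U) s2t min_t]|J].
  (* Minimality of [t] is tested against the triangle [m] built from the extreme coordinates. *)
  have [m J] := exists_join U1 U2; have [Um ex ey es] := J.
  have /(containedP U Um) tm : contained R t m.
    by apply: min_t => //; apply/containedP; rewrite // /sub; lia.
  by move: s1t s2t tm; rewrite /sub => ? ? ?; split=> //; lia.
have [U ex ey es] := J; split=> // [||t' U' /(containedP U1 U') h1 /(containedP U2 U') h2].
- by apply/containedP => //; apply: sub_joinl J.
- by apply/containedP => //; apply: sub_joinr J.
by apply/containedP => //; move: h1 h2; rewrite /sub; lia.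
Qed.

Lemma replace_stepP A B : (forall t, t \in A -> upward t) ->
  replace_step R A B <-> step A B.
Proof.
move=> UA; split=> -[t1 [t2 [t [A1 A2 H J ->]]]]; exists t1, t2, t.
  by split=> //; [apply/meet_in_pointP; auto | apply/is_joinP; auto].
by split=> //; [apply/meet_in_pointP; auto | apply/is_joinP; auto].
Qed.

Lemma upward_step A B : (forall t, t \in A -> upward t) -> step A B ->
  forall t, t \in B -> upward t.
Proof.
move=> UA [t1 [t2 [t [_ _ _ [U _ _ _] ->]]]] t'.
by rewrite !inE => /orP[/eqP->|/and3P[_ _ /UA]].
Qed.

(** Single steps correspond only between sets of upward triangles, so both inductions carry this
    property along. *)
Lemma reduces_toP A B : (forall t, t \in A -> upward t) ->
  reduces_to R A B <-> steps A B.
Proof.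
move=> UA; split=> AB.
  suff [] : (forall t, t \in B -> upward t) /\ steps A B by [].
  elim: AB UA => {A B} [A B AB UA|A UA|A B C _ IH _ IH' UA].
  - have AB' : step A B by apply/replace_stepP.
    by split; [apply: upward_step AB' | apply: rt_step].
  - by split=> //; apply: rt_refl.
  - have [UB AB] := IH UA; have [UC BC] := IH' UB.
    by split=> //; apply: rt_trans AB BC.
suff [] : (forall t, t \in B -> upward t) /\ reduces_to R A B by [].
elim: AB UA => {A B} [A B AB UA|A UA|A B C _ IH _ IH' UA].
- by split; [apply: upward_step AB | apply: rt_step; apply/replace_stepP].
- by split=> //; apply: rt_refl.
- have [UB AB] := IH UA; have [UC BC] := IH' UB.
  by split=> //; apply: rt_trans AB BC.
Qed.

End Points.

Theorem mainTheorem2 (R : realType) (n : nat) (hn : 0 < n) (S : {set tri n})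
    (hS : spread_out R S) :
  (exists! T : {set {set tri n}}, rhombus_tiling (holey_region S) T) <->
  reduces_to R S [set whole hn].
Proof.
have [card_S S_unit spread] := hS.
have S_up1 s : s \in S -> up1 s by move=> /S_unit[U k]; rewrite /up1 U k.
have spread' t : upward t -> #|[set s in S | sub s t]| <= side t.
  move=> U; apply: leq_trans (spread t U); apply/subset_leq_card/fintype.subsetP => s.
  by rewrite !inE => /andP[sS st]; rewrite sS; apply/asboolP/containedP;
    rewrite ?(up1_upward (S_up1 s sS)).
rewrite reduces_toP => [|t /S_up1/up1_upward //].
split; last exact: steps_unique_tiling.
by apply: unique_tiling_steps; rewrite // -card_gt0 card_S.
Qed.
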